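(* Suppose $l<p$. Then every strict equivalence class of surjective characters $U_1\to\mathbb{Z}/p^2\mathbb{Z}$ of type $\langle l,m\rangle$ contains exactly one character in reduced form, i.e. of standard expansion $$x_l\,\mathfrak{Z}_l+\sum_{\substack{m-l\le j\le m\\ p\nmid j}} b_j\cdot p\,\mathfrak{Z}_j,$$ with $x_l,b_j\in\{0,\dots,p-1\}$, $x_l\ne0$, and $b_m\ne0$ if $p\nmid m$. Equivalently, two distinct reduced forms of type $\langle l,m\rangle$ are never strictly equivalent.
   Context: Let $p$ be a prime, $K=\mathbb{F}_p((t))$, $U_1=1+t\mathbb{F}_p[[t]]$ the group of principal units, and $U_j=1+t^j\mathbb{F}_p[[t]]$ for $j\ge1$; $U_1$ carries the $t$-adic topology. The Nottingham group $\mathcal{N}$ over $\mathbb{F}_p$ is the set of power series $u(t)=t(1+c_1t+c_2t^2+\cdots)$ with $c_i\in\mathbb{F}_p$, a group under composition. A character is a continuous homomorphism $\chi:U_1\to\mathbb{Z}/p^2\mathbb{Z}$ (discrete topology on the target). $\mathcal{N}$ acts on characters by ${}_u\chi(f(t))=\chi(f(u(t)))$ for $f\in U_1$. Two characters $\chi,\psi$ are strictly equivalent, $\chi\simeq\psi$, if there is $u\in\mathcal{N}$ with $\psi={}_u\chi$ and $\chi(u(t)/t)=0$. A surjective character $\chi$ has type (break sequence) $\langle l,m\rangle$ where $l$ is the largest integer $b$ with $\chi(U_b)\not\subset p\mathbb{Z}/p^2\mathbb{Z}$ and $m$ is the largest integer $b$ with $\chi(U_b)\neq 0$. Put $E_j=1+t^j$.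 The elements $E_j$ with $p\nmid j$ form a topological $\mathbb{Z}_p$-basis of $U_1$; for $p\nmid j$, $\mathfrak{Z}_j$ denotes the character with $\mathfrak{Z}_j(E_i)=\delta_{ij}$ for all $i$ with $p\nmid i$. Every character of type $\langle l,m\rangle$ can be written uniquely in standard expansion $\chi=\sum_{1\le i\le l,\,p\nmid i}x_i\mathfrak{Z}_i+\sum_{1\le j\le m,\,p\nmid j}a_j\cdot p\,\mathfrak{Z}_j$ with $x_i,a_j\in\{0,\dots,p-1\}$. *)

(* Defs.v *)
From HB Require Import structures.
From mathcomp Require Import all_boot all_order all_algebra.
Set Implicit Arguments. Unset Strict Implicit. Unset Printing Implicit Defensive.
Import GRing.Theory.
Local Open Scope ring_scope.

(* Formal power series over F_p, as coefficient sequences: f n = coeff of t^n. *)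
Definition ps (p : nat) := nat -> 'F_p.

Definition psmul (p : nat) (f g : ps p) : ps p :=
  fun n => \sum_(i < n.+1) f i * g (n - i)%N.

Definition psone (p : nat) : ps p := fun n => if n == 0%N then 1 else 0.

Definition pspow (p : nat) (u : ps p) (k : nat) : ps p := iter k (psmul u) (psone p).

(* composition f(u(t)), for u of t-adic valuation >= 1 *)
Definition pscomp (p : nat) (f u : ps p) : ps p :=
  fun n => \sum_(k < n.+1) f k * pspow u k n.

(* U_j = 1 + t^j F_p[[t]]  (for j >= 1; U_1 is the group of principal units) *)
Definition inU (p : nat) (j : nat) (f : ps p) : Prop :=
  f 0%N = 1 /\ forall i, (0 < i)%N -> (i < j)%N -> f i = 0.
Definition inU1 (p : nat) (f : ps p) : Prop := inU 1 f.

Definition E (p : nat) (j : nat) : ps p :=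
  fun n => if n == 0%N then 1 else if n == j then 1 else 0.

Definition nottingham (p : nat) (u : ps p) : Prop := u 0%N = 0 /\ u 1%N = 1.

Definition div_t (p : nat) (u : ps p) : ps p := fun n => u n.+1.

(* characters U_1 -> Z/p^2Z: homomorphisms (on U_1) which are continuous
   (locally constant for the t-adic topology, target discrete). *)
Definition is_character (p : nat) (chi : ps p -> 'Z_(p ^ 2)) : Prop :=
  (forall f g, inU1 f -> inU1 g -> chi (psmul f g) = chi f + chi g) /\
  (forall f, inU1 f -> exists N : nat, forall g, inU1 g ->
       (forall i, (i < N)%N -> g i = f i) -> chi g = chi f).

Definition surjective_char (p : nat) (chi : ps p -> 'Z_(p ^ 2)) : Prop :=
  forall z : 'Z_(p ^ 2), exists f, inU1 f /\ chi f = z.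

Definition strict_equiv (p : nat) (chi psi : ps p -> 'Z_(p ^ 2)) : Prop :=
  exists u : ps p, nottingham u /\
    (forall f, inU1 f -> psi f = chi (pscomp f u)) /\
    chi (div_t u) = 0.

Definition has_type (p : nat) (chi : ps p -> 'Z_(p ^ 2)) (l m : nat) : Prop :=
  ((exists f, inU l f /\ ~~ (p %| chi f)%N) /\
   (forall b, (l < b)%N -> forall f, inU b f -> (p %| chi f)%N)) /\
  ((exists f, inU m f /\ chi f != 0) /\
   (forall b, (m < b)%N -> forall f, inU b f -> chi f = 0)).

(* reduced form: standard expansion x_l Z_l + sum_{m-l<=j<=m, p∤j} b_j p Z_j,
   expressed through the defining property Z_j(E_i) = delta_ij (p ∤ i), i.e.
   through the values chi(E_i) = x_i + p a_i of the standard expansion. *)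
Definition reduced_form (p : nat) (chi : ps p -> 'Z_(p ^ 2)) (l m : nat) : Prop :=
  exists (x : nat) (b : nat -> nat),
    [/\ (0 < x < p)%N, (forall j, (b j < p)%N),
        (~~ (p %| m)%N -> b m != 0%N) &
        forall i, (0 < i)%N -> ~~ (p %| i)%N ->
          chi (E p i) =
          (((if i == l then x else 0) +
            p * (if (m - l <= i <= m)%N then b i else 0))%N)%:R].

(* Main.v *)
Require Import Defs.
From HB Require Import structures.
From mathcomp Require Import all_boot all_order all_algebra.
From mathcomp Require Import zify.
Set Implicit Arguments. Unset Strict Implicit. Unset Printing Implicit Defensive.
Import GRing.Theory.
Local Open Scope ring_scope.

(** If [u = t + c t^(k+1) + ...], then [E_j(u) / E_j = 1 + j c t^(j+k) + ...].
    Hence a substitution of depth [k] leaves [p chi(E_j)] fixed for [j + k > l]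
    and [chi(E_j)] fixed for [j + k > m], while on the borderline [j + k = l]
    (resp. [j + k = m]) with [p] prime to [j] it shifts the value by an
    arbitrary multiple of [p], chosen through [c].

    Existence: compose substitutions of depth [k = 1, ..., m].  Depth [k < l]
    kills [chi(E_(l-k))] modulo [p]; depth [l] makes [chi(u/t)] vanish modulo
    [p]; depth [l < k < m] removes the [p]-part of [chi(E_(m-k))]; depth [m]
    makes [chi(u/t)] vanish.

    Uniqueness: if [u] carries a reduced form to a reduced form, the borderline
    terms modulo [p], together with [chi(u/t) = 0], force the depth of [u] to
    exceed [l].  So [chi(E_j)] is unchanged for [j >= m - l], and below that
    range both expansions are determined modulo [p]. *)

(** Lets a series be solved for one coefficient at a time, each depending on all earlier ones: used
    to invert a substitution and to divide by a principal unit. *)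
Lemma course_of_values_rec (A : Type) (F : nat -> seq A -> A) :
  exists s : nat -> A, forall n, s n = F n (mkseq s n).
Proof.
pose pre := fix pre n := if n is k.+1 then rcons (pre k) (F k (pre k)) else [::].
exists (fun n => F n (pre n)) => n; congr F.
by elim: n => //= n IHn; rewrite mkseqS IHn.
Qed.

(** * Power series *)

(** Congruence modulo [t^N] with a polynomial, so that identities between series reduce to
    polynomial algebra on truncations. *)
Definition approx (p N : nat) (f : ps p) (P : {poly 'F_p}) :=
  forall i, (i < N)%N -> f i = P`_i.

Lemma approx_trunc (p N : nat) (f : ps p) : approx N f (\poly_(i < N) f i).
Proof. by move=> i ltiN; rewrite coef_poly ltiN. Qed.

Lemma approx_mul (p N : nat) (f g : ps p) P Q :
  approx N f P -> approx N g Q -> approx N (psmul f g) (P * Q).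
Proof.
move=> fP gQ i ltiN; rewrite /psmul coefM; apply: eq_bigr => j _.
by rewrite fP ?gQ //; have := ltn_ord j; lia.
Qed.

Lemma approx_pow (p N : nat) (f : ps p) P k :
  approx N f P -> approx N (pspow f k) (P ^+ k).
Proof.
move=> fP; elim: k => [|k IHk]; last by rewrite exprS; apply: approx_mul.
by move=> i _; rewrite expr0 coef1 /pspow /= /psone; case: eqP.
Qed.

Lemma coef_exp_lt (R : nzRingType) (P : {poly R}) k n :
  P`_0 = 0 -> (n < k)%N -> (P ^+ k)`_n = 0.
Proof.
move=> P0; elim: k n => // k IHk n ltnk; rewrite exprS coefM big1 // => -[j ltj] _ /=.
case: j ltj => [|j] ltj; first by rewrite P0 mul0r.
by rewrite IHk ?mulr0 //; lia.
Qed.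

Lemma approx_comp (p N : nat) (f u : ps p) P Q :
  approx N f P -> approx N u Q -> Q`_0 = 0 -> approx N (pscomp f u) (P \Po Q).
Proof.
move=> fP uQ Q0 i ltiN; rewrite /pscomp coef_comp_poly.
pose F k := P`_k * (Q ^+ k)`_i.
have -> : \sum_(k < i.+1) f k * pspow u k i = \sum_(k < i.+1) F k.
  apply: eq_bigr => k _; rewrite fP ?(approx_pow k uQ) //.
  by have := ltn_ord k; lia.
(* The sums have lengths [i.+1] and [size P]; both are padded to the maximum. A surplus term
   vanishes because [P] has no such coefficient, or because [Q ^+ k] has valuation at least
   [k > i]. *)
rewrite -/(F _) (big_ord_widen (maxn i.+1 (size P)) F) ?leq_maxl //.
rewrite [RHS](big_ord_widen (maxn i.+1 (size P)) F) ?leq_maxr //.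
rewrite big_mkcond [RHS]big_mkcond; apply: eq_bigr => k _; rewrite /F.
case: ltnP => lt1; case: ltnP => lt2 //.
  by rewrite nth_default // mul0r.
by rewrite coef_exp_lt ?mulr0.
Qed.

Lemma pscompM (p : nat) (f g u : ps p) : u 0%N = 0 ->
  pscomp (psmul f g) u =1 psmul (pscomp f u) (pscomp g u).
Proof.
move=> u0 n; have fA := @approx_trunc p n.+1 f; have gA := @approx_trunc p n.+1 g.
have uA := @approx_trunc p n.+1 u.
have U0 : (\poly_(i < n.+1) u i)`_0 = 0 by rewrite coef_poly.
rewrite (approx_comp (approx_mul fA gA) uA U0) // comp_polyM.
by rewrite (approx_mul (approx_comp fA uA U0) (approx_comp gA uA U0)).
Qed.

Lemma pscomp0 (p : nat) (f u : ps p) : pscomp f u 0%N = f 0%N.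
Proof. by rewrite /pscomp big_ord1 mulr1. Qed.

Lemma pscompA (p : nat) (f v u : ps p) : v 0%N = 0 -> u 0%N = 0 ->
  pscomp (pscomp f v) u =1 pscomp f (pscomp v u).
Proof.
move=> v0 u0 n; have fA := @approx_trunc p n.+1 f; have vA := @approx_trunc p n.+1 v.
have uA := @approx_trunc p n.+1 u.
have U0 : (\poly_(i < n.+1) u i)`_0 = 0 by rewrite coef_poly.
have V0 : (\poly_(i < n.+1) v i)`_0 = 0 by rewrite coef_poly.
rewrite (approx_comp (approx_comp fA vA V0) uA U0) // -comp_polyA.
apply/esym/(approx_comp fA (approx_comp vA uA U0)) => //.
by rewrite -(approx_comp vA uA U0) // pscomp0.
Qed.

Lemma eq_pscomp (p : nat) (f u v : ps p) : u =1 v -> pscomp f u =1 pscomp f v.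
Proof.
move=> uv n; apply: eq_bigr => k _; congr (_ * _).
move: (nat_of_ord k) => {k} j; elim: j n => // j IHj n; rewrite /pspow !iterS -!/(pspow _ _).
by apply: eq_bigr => i _; rewrite uv IHj.
Qed.

Lemma approx_div_t (p N : nat) (v : ps p) P : v 0%N = 0 ->
  approx N (div_t v) P -> approx N.+1 v ('X * P).
Proof. by move=> v0 vP [|i] ltiN; rewrite coefXM //= -vP. Qed.

(** Writing [v = t w] gives [v(u) = u w(u)]. This is the cocycle rule by which [chi(u/t)] is tracked
    under composition. *)
Lemma div_t_comp (p : nat) (v u : ps p) : v 0%N = 0 -> u 0%N = 0 ->
  div_t (pscomp v u) =1 psmul (pscomp (div_t v) u) (div_t u).
Proof.
move=> v0 u0 n; have vA := @approx_trunc p n.+1 (div_t v).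
have uA := @approx_trunc p n.+1 (div_t u).
have vA' := approx_div_t v0 vA; have uA' := approx_div_t u0 uA.
set P := \poly_(_ < _) _ in vA vA'; set Q := \poly_(_ < _) _ in uA uA'.
have Q0 : ('X * Q)`_0 = 0 by rewrite coefXM.
have uA2 : approx n.+1 u ('X * Q) by move=> i lti; apply: uA'; lia.
rewrite {1}/div_t (approx_comp vA' uA' Q0) // (approx_mul (approx_comp vA uA2 Q0) uA) //.
by rewrite comp_polyM comp_polyX -mulrA coefXM /= mulrC.
Qed.

Lemma pspowE (p : nat) (f : ps p) k n :
  pspow f k n = ((\poly_(i < n.+1) f i) ^+ k)`_n.
Proof. by rewrite (approx_pow k (@approx_trunc p n.+1 f)). Qed.

Lemma pspow_lt (p : nat) (u : ps p) k n : u 0%N = 0 -> (n < k)%N -> pspow u k n = 0.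
Proof. by move=> u0 ltnk; rewrite pspowE coef_exp_lt // coef_poly. Qed.

Lemma pspowS (p : nat) (u : ps p) k : pspow u k.+1 = psmul u (pspow u k).
Proof. by []. Qed.

(** First-order binomial expansion of [t^k (1 + c t^d + ...)^k], with [c] the coefficient
    [u d.+1]. *)
Lemma pspow_leading (p : nat) (u : ps p) d k : nottingham u -> (0 < d)%N ->
    (forall i, (1 < i <= d)%N -> u i = 0) ->
  [/\ pspow u k k = 1, forall i, (0 < i < d)%N -> pspow u k (k + i)%N = 0
    & pspow u k (k + d)%N = k%:R * u d.+1].
Proof.
move=> [u0 u1] d0 ud.
(* A single formula covering all three claims makes the induction on [k] go through. *)
suff H i : (i <= d)%N ->
    pspow u k (k + i)%N = (i == 0%N)%:R + (i == d)%:R * (k%:R * u d.+1).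
  split; first by rewrite -{2}[k]addn0 H // (ltn_eqF d0) mul0r addr0.
    by move=> i /andP[i0 id]; rewrite H 1?ltnW // (gtn_eqF i0) (ltn_eqF id) mul0r addr0.
  by rewrite H // eqxx gtn_eqF // mul1r add0r.
elim: k i => [|k IHk] i led.
  by rewrite mul0r mulr0 addr0 add0n /pspow /= /psone; case: eqP.
rewrite pspowS /psmul addSn big_ord_recl /= u0 mul0r add0r.
rewrite big_ord_recl /= u1 mul1r.
have -> : ((k + i).+1 - bump 0 0 = k + i)%N by rewrite /bump /=; lia.
rewrite IHk // -natr1 mulrDl mul1r mulrDr addrA; congr (_ + _).
have [->|neid] := eqVneq i d; last first.
  rewrite mul0r big1 // => j _; rewrite /bump /=.
  case: (leqP j.+2 d) => ltj; first by rewrite add1n ud ?mul0r //; lia.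
  rewrite pspow_lt ?mulr0 //; have := ltn_ord j; lia.
(* With the first two terms split off, index [d.-1] is the one carrying [u d.+1]. *)
have ltd : (d.-1 < k + d)%N by lia.
rewrite (bigD1 (Ordinal ltd)) //= big1 ?addr0.
  rewrite /bump /= mul1r (_ : (1 + (1 + d.-1) = d.+1)%N); last by lia.
  by rewrite (_ : ((k + d).+1 - d.+1 = k + 0)%N) ?IHk //= ?(ltn_eqF d0) ?mul0r ?addr0 ?mulr1 //; lia.
move=> j nej; have {}nej : (j : nat) != d.-1 by apply: contra nej => /eqP e; apply/eqP/val_inj.
rewrite /bump /=; case: (leqP j.+2 d) => ltj; first by rewrite add1n ud ?mul0r //; lia.
by rewrite pspow_lt ?mulr0 //; have := ltn_ord j; lia.
Qed.

Lemma pspow_diag (p : nat) (u : ps p) k : nottingham u -> pspow u k k = 1.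
Proof. by move=> nu; case: (@pspow_leading p u 1 k nu) => // i; lia. Qed.

Lemma pscomp_recr (p : nat) (f u : ps p) n : nottingham u ->
  pscomp f u n = \sum_(k < n) f k * pspow u k n + f n.
Proof. by move=> nu; rewrite /pscomp big_ord_recr /= pspow_diag // mulr1. Qed.

(** By [pscomp_recr], substitution is a unitriangular system in the coefficients of [f], solvable
    from the bottom up. *)
Lemma pscomp_surj (p : nat) (u : ps p) (g : ps p) : nottingham u ->
  exists f, pscomp f u =1 g.
Proof.
move=> nu; have [f fE] := course_of_values_rec
  (fun n s => g n - \sum_(k < n) s`_k * pspow u k n).
exists f => n; rewrite pscomp_recr // [f n]fE addrC.
rewrite (_ : \sum_(k < n) f k * _ = \sum_(k < n) (mkseq f n)`_k * pspow u k n) ?subrK //.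
by apply: eq_bigr => k _; rewrite nth_mkseq.
Qed.

(** * The filtration of the principal units by the groups [U_j] *)

Lemma inU_le (p : nat) (f : ps p) j k : (j <= k)%N -> inU k f -> inU j f.
Proof. by move=> lejk [f0 fk]; split=> // i i0 lti; apply: fk => //; lia. Qed.

Lemma inU_inU1 (p : nat) (f : ps p) j : inU j f -> inU1 f.
Proof. by case=> f0 _; split=> // i; lia. Qed.

Lemma inU1P (p : nat) (f : ps p) : inU1 f <-> f 0%N = 1.
Proof. by split=> [[]//|f0]; split=> // i; lia. Qed.

Lemma eq_inU (p : nat) (f g : ps p) j : f =1 g -> inU j f -> inU j g.
Proof. by move=> fg [f0 fj]; split=> [|i i0 lti]; rewrite -fg //; apply: fj. Qed.

Lemma inU_leading (p : nat) (f : ps p) j : (0 < j)%N -> inU j f -> f j = 0 -> inU j.+1 f.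
Proof.
move=> j0 [f0 fj] fj0; split=> // i i0; rewrite ltnS leq_eqVlt => /orP[/eqP->|] //.
exact: fj.
Qed.

Lemma inU_comp (p : nat) (f u : ps p) j : nottingham u ->
  inU j (pscomp f u) <-> inU j f.
Proof.
move=> nu; rewrite /inU pscomp0; split=> -[f0 fj]; split=> // i.
  elim/ltn_ind: i => i IHi i0 lti; have := fj i i0 lti; rewrite pscomp_recr //.
  rewrite big1 ?add0r // => -[[|k] ltk] _ /=.
    by rewrite /pspow /= /psone gtn_eqF // mulr0.
  by rewrite IHi ?mul0r //; lia.
move=> i0 lti; rewrite pscomp_recr // fj // addr0 big1 // => -[[|k] ltk] _ /=.
  by rewrite /pspow /= /psone gtn_eqF // mulr0.
by rewrite fj ?mul0r //; lia.
Qed.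

Lemma inU_mul (p : nat) (f g : ps p) j : (0 < j)%N -> inU j f -> inU j g ->
  inU j (psmul f g) /\ psmul f g j = f j + g j.
Proof.
move=> j0 [f0 fj] [g0 gj].
have H i : (0 < i)%N -> (i <= j)%N -> psmul f g i = f i + g i.
  move=> i0 lei; rewrite /psmul big_ord_recl /= subn0 f0 mul1r.
  case: i i0 lei => // i _ lei; rewrite big_ord_recr /= subnn g0 mulr1 big1 ?add0r 1?addrC //.
  by move=> k _; rewrite /bump /= fj ?mul0r //; have := ltn_ord k; lia.
split; last exact: H.
split=> [|i i0 lti]; first by rewrite /psmul big_ord1 f0 g0 mulr1.
by rewrite H ?fj ?gj ?addr0 // ltnW.
Qed.

Lemma inU_psone (p : nat) j : inU j (psone p).
Proof. by split=> // -[|i]. Qed.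

Lemma inU_pow (p : nat) (f : ps p) j n : (0 < j)%N -> inU j f ->
  inU j (pspow f n) /\ pspow f n j = f j *+ n.
Proof.
move=> j0 fj; elim: n => [|n [IH1 IH2]].
  by split; [apply: inU_psone | rewrite /pspow /= /psone gtn_eqF].
by have [H1 H2] := inU_mul j0 fj IH1; rewrite mulrS -IH2.
Qed.

Lemma inU_E (p : nat) j : (0 < j)%N -> inU j (E p j) /\ E p j j = 1.
Proof.
move=> j0; split; last by rewrite /E gtn_eqF // eqxx.
by split=> // i i0 lti; rewrite /E gtn_eqF // ltn_eqF.
Qed.

Lemma psmul_surj (p : nat) (f g : ps p) : inU1 g -> exists h, psmul g h =1 f.
Proof.
case=> g0 _; have [h hE] := course_of_values_rec
  (fun n s => f n - \sum_(i < n) g i.+1 * s`_(n - i.+1)).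
exists h => n; rewrite /psmul big_ord_recl /= subn0 g0 mul1r {1}hE.
rewrite (_ : \sum_(i < n) _ = \sum_(i < n) g (bump 0 i) * h (n - bump 0 i)%N) ?subrK //.
by apply: eq_bigr => i _; rewrite nth_mkseq ?/bump //; have := ltn_ord i; lia.
Qed.

(** Reduces the comparison of two units agreeing below [j] to an element of [U_j] with known leading
    coefficient. *)
Lemma psmul_quotient (p j : nat) (f g : ps p) : (0 < j)%N -> inU1 f -> inU1 g ->
    (forall i, (i < j)%N -> f i = g i) ->
  exists h, [/\ inU j h, h j = f j - g j & psmul g h =1 f].
Proof.
move=> j0 [f0 _] [g0 g1] fg; have [h hE] := psmul_surj f (conj g0 g1).
have h0 : h 0%N = 1 by have := hE 0%N; rewrite /psmul big_ord1 g0 mul1r f0.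
have H i : (0 < i)%N -> (i <= j)%N -> h i = f i - g i.
  elim/ltn_ind: i => -[//|i] IHi _ lei; rewrite -hE /psmul big_ord_recl big_ord_recr /=.
  rewrite g0 mul1r subnn h0 mulr1 big1 ?add0r ?addrK // => k _.
  rewrite /bump /=; have ltk := ltn_ord k; have e : (i.+1 - (1 + k) = i - k)%N by lia.
  by rewrite e IHi ?fg ?subrr ?mulr0 //; lia.
exists h; split; [|exact: H|exact: hE].
by split=> // i i0 lti; rewrite H ?(fg i) ?subrr // ltnW.
Qed.

Lemma approx_E (p N i : nat) : (0 < i)%N -> approx N (E p i) (1 + 'X^i).
Proof.
move=> i0 k _; rewrite /E coefD coef1 coefXn.
by case: eqP => [->|_]; [rewrite (ltn_eqF i0) addr0 | case: eqP; rewrite add0r].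
Qed.

(** Frobenius is additive in characteristic [p]. Hence every [E_i] with [p] dividing [i] is a [p]-th
    power of an earlier one. *)
Lemma pspow_E_prime (p i : nat) : prime p -> (0 < i)%N ->
  pspow (E p i) p =1 E p (i * p).
Proof.
move=> pr i0 n; have pc : p \in [pchar {poly 'F_p}] by rewrite (pchar_poly 'F_p) pchar_Fp.
rewrite (approx_pow p (@approx_E p n.+1 _ i0)) // -(pFrobenius_autE pc).
rewrite pFrobenius_autD_comm; last by rewrite /GRing.comm mul1r mulr1.
rewrite !pFrobenius_autE expr1n -exprM (@approx_E p n.+1 _) //.
by rewrite muln_gt0 i0 prime_gt0.
Qed.

(** Since [E_j(u) = 1 + u^j], this is [pspow_leading] at exponent [j]. *)
Lemma E_comp_leading (p : nat) (u : ps p) d j : nottingham u -> (0 < d)%N -> (0 < j)%N ->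
    (forall i, (1 < i <= d)%N -> u i = 0) ->
  (forall i, (i < j + d)%N -> pscomp (E p j) u i = E p j i) /\
  pscomp (E p j) u (j + d)%N - E p j (j + d)%N = j%:R * u d.+1.
Proof.
move=> nu d0 j0 ud; have [u0 _] := nu.
have [pj plt pd] := pspow_leading j nu d0 ud.
have H n : pscomp (E p j) u n = psone p n + pspow u j n.
  have U0 : (\poly_(i < n.+1) u i)`_0 = 0 by rewrite coef_poly.
  rewrite (approx_comp (@approx_E p n.+1 _ j0) (@approx_trunc p n.+1 u) U0) //.
  rewrite comp_polyD comp_polyC comp_Xn_poly coefD -pspowE coef1 /psone.
  by case: eqP.
split=> [i lti|]; rewrite H /E /psone; last first.
  by rewrite pd !gtn_eqF ?subr0 ?add0r //; lia.
case: (ltngtP i j) => [ltij|ltji|->].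
- by rewrite pspow_lt // addr0.
- rewrite gtn_eqF ?(ltn_trans _ ltji) // add0r -(subnKC (ltnW ltji)) plt //; lia.
- by rewrite pj gtn_eqF // add0r.
Qed.

(** * Torsion in Z/p^2 *)

Lemma prime_sqr_gt1 p : prime p -> (1 < p ^ 2)%N.
Proof. by move=> pr; rewrite -(exp1n 2) ltn_exp2r ?prime_gt1. Qed.

Lemma ltn_Zp2 p (z : 'Z_(p ^ 2)) : prime p -> (z < p ^ 2)%N.
Proof. by move=> pr; rewrite -[X in (_ < X)%N](Zp_cast (prime_sqr_gt1 pr)). Qed.

(** Multiplication by [p] identifies ['F_p] with the [p]-torsion of Z/p^2. *)
Lemma natr_Zp2_eq p m n : prime p ->
  (m * p)%:R = (n * p)%:R :> 'Z_(p ^ 2) <-> m%:R = n%:R :> 'F_p.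
Proof.
move=> pr; have p0 := prime_gt0 pr; have p2 := prime_sqr_gt1 pr.
have eZ : ((m * p)%:R = (n * p)%:R :> 'Z_(p ^ 2)) <-> (m %% p = n %% p)%N.
  split=> [/(congr1 (@nat_of_ord _))|e]; last apply: val_inj => /=.
    rewrite !(val_Zp_nat p2) -mulnn -!muln_modl => /eqP.
    by rewrite eqn_pmul2r // => /eqP.
  by rewrite !(val_Zp_nat p2) -mulnn -!muln_modl e.
rewrite eZ; split=> [e|/(congr1 (@nat_of_ord _))]; last by rewrite !(val_Fp_nat pr).
by apply: val_inj; rewrite /= !(val_Fp_nat pr).
Qed.

Lemma mulrn_nat_Zp2 p (z : 'Z_(p ^ 2)) n : z *+ n = (z * n)%:R.
Proof. by rewrite -{1}(natr_Zp z) -mulrnA. Qed.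

(** Turns a condition on [chi] modulo [p] into a vanishing statement for [p chi], so that both
    breaks can be treated alike. *)
Lemma dvdn_Zp2 p (z : 'Z_(p ^ 2)) : prime p -> (p %| z)%N = (z *+ p == 0).
Proof.
move=> pr; have e := @natr_Zp2_eq p z 0 pr; rewrite mul0n in e.
by rewrite mulrn_nat_Zp2 (dvdn_pcharf (pchar_Fp pr)); apply/eqP/eqP => /e.
Qed.

Lemma Zp2_torsionP p (z : 'Z_(p ^ 2)) : prime p -> z *+ p = 0 ->
  exists k, (z : nat) = (k * p)%N.
Proof. by move=> pr /eqP; rewrite -dvdn_Zp2 // => /dvdnP. Qed.

Lemma mulrn_Fp_nat p (a : 'Z_(p ^ 2)) n : prime p -> a *+ p = 0 ->
  a *+ (n%:R : 'F_p) = a *+ n.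
Proof.
move=> pr ap; rewrite (val_Fp_nat pr) {2}(divn_eq n p) mulrnDr mulnC mulrnA ap.
by rewrite mul0rn add0r.
Qed.

(** The [p]-torsion is a line over ['F_p]; the scalar is the ratio of the cofactors of [p] in [b]
    and [a]. *)
Lemma torsion_span p (a b : 'Z_(p ^ 2)) : prime p -> a *+ p = 0 -> b *+ p = 0 ->
  a != 0 -> exists c : 'F_p, a *+ c = b.
Proof.
move=> pr ap bp a0; have [a' aE] := Zp2_torsionP pr ap.
have [b' bE] := Zp2_torsionP pr bp.
have a'0 : a'%:R != 0 :> 'F_p.
  apply: contra a0 => /eqP e; apply/eqP.
  by have := @natr_Zp2_eq p a' 0 pr; rewrite mul0n -(natr_Zp a) aE => /iffRL; apply.
exists (b'%:R / a'%:R).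
rewrite mulrn_nat_Zp2 aE -[RHS]natr_Zp bE mulnAC; apply/natr_Zp2_eq => //.
by rewrite natrM natr_Zp mulrC divfK.
Qed.

Lemma mulrn_Fp_eq0 p (a : 'Z_(p ^ 2)) (c : 'F_p) : prime p -> a *+ p = 0 ->
  a != 0 -> a *+ c = 0 -> c = 0.
Proof.
move=> pr ap a0 ac; apply/eqP; apply: contraTT isT => c0.
(* As a natural number [c * c^-1] is congruent to 1 modulo [p], so [a] itself is a multiple of
   [a *+ c = 0]. *)
have := mulrn_Fp_nat (c * (c^-1 : 'F_p))%N pr ap.
rewrite natrM !natr_Zp mulfV // mulrnA ac mul0rn => /eqP.
by rewrite -(mulr1n 1) mulrn_Fp_nat // (negPf a0).
Qed.

(** * Characters *)

(** For [chi] this is the break [m], for [p chi] the break [l]. *)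
Definition conductor p (theta : ps p -> 'Z_(p ^ 2)) q :=
  (exists f, inU q f /\ theta f != 0) /\ (forall f, inU q.+1 f -> theta f = 0).

Section Characters.
Variables (p : nat) (chi : ps p -> 'Z_(p ^ 2)).
Hypothesis hchi : is_character chi.

(** Continuity at [f] suffices: a series with the same coefficients agrees with [f] below any bound
    [N]. *)
Lemma char_ext f g : inU1 f -> f =1 g -> chi f = chi g.
Proof.
move=> f1 fg; case: hchi => _ /(_ f f1)[N HN]; apply/esym/HN => //.
exact: eq_inU fg f1.
Qed.

Lemma char_mul f g : inU1 f -> inU1 g -> chi (psmul f g) = chi f + chi g.
Proof. by case: hchi => H _; apply: H. Qed.

Lemma char_one : chi (psone p) = 0.
Proof.
have one1 := inU_psone p 1; apply: (addrI (chi (psone p))).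
rewrite -char_mul // addr0; apply/esym/char_ext => // n.
rewrite /psmul big_ord_recl /= subn0 mul1r big1 ?addr0 // => i _.
by rewrite /psone /= mul0r.
Qed.

Lemma char_pow f n : inU1 f -> chi (pspow f n) = chi f *+ n.
Proof.
move=> f1; elim: n => [|n IHn]; first by rewrite char_one.
rewrite pspowS char_mul // ?IHn ?mulrS //.
by case: (inU_pow n (ltn0Sn 0) f1).
Qed.

Lemma is_character_mulrn n : is_character (fun f => chi f *+ n).
Proof.
split=> [f g f1 g1|f f1]; first by rewrite char_mul // mulrnDl.
by case: hchi => _ /(_ f f1)[N HN]; exists N => g g1 gf; rewrite (HN g).
Qed.

Lemma is_character_comp u : nottingham u -> is_character (fun f => chi (pscomp f u)).
Proof.
move=> nu; have [u0 _] := nu.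
have cU f : inU1 f -> inU1 (pscomp f u) by move/(inU_comp f 1 nu).
split=> [f g f1 g1|f f1].
  rewrite -char_mul; try exact: cU.
  apply: char_ext; last exact: pscompM.
  by apply: (cU); case: (inU_mul (ltn0Sn 0) f1 g1).
case: hchi => _ /(_ _ (cU f f1))[N HN]; exists N => g g1 gf; apply: HN; first exact: cU.
move=> i ltiN; apply: eq_bigr => k _; rewrite gf //; have := ltn_ord k; lia.
Qed.

Lemma char_quotient j f g : (0 < j)%N -> inU1 f -> inU1 g ->
    (forall i, (i < j)%N -> f i = g i) ->
  exists h, [/\ inU j h, h j = f j - g j & chi f = chi g + chi h].
Proof.
move=> j0 f1 g1 fg; have [h [hj hjE hE]] := psmul_quotient j0 f1 g1 fg.
exists h; split=> //; rewrite -char_mul //; last exact: inU_inU1 hj.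
by apply: char_ext => // n; rewrite hE.
Qed.

(** Dividing [f] by the power of [E_j] with the same leading coefficient moves it one step down the
    filtration. *)
Lemma char_leading j f : (0 < j)%N -> inU j f ->
  exists h, inU j.+1 h /\ chi f = chi (E p j) *+ f j + chi h.
Proof.
move=> j0 fj; have [Ej Ejj] := inU_E p j0; have [g1 g2] := inU_pow (f j) j0 Ej.
have f1 := inU_inU1 fj.
have fg i : (i < j)%N -> f i = pspow (E p j) (f j) i.
  by case: (fj) (g1) => f0 fi [g0 gi]; case: i => [|i] lti; rewrite ?f0 // fi ?gi.
have [h [hj hjE ->]] := char_quotient j0 f1 (inU_inU1 g1) fg.
exists h; rewrite char_pow; last exact: inU_inU1 Ej.
by split=> //; apply: inU_leading; rewrite // hjE g2 Ejj natr_Zp subrr.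
Qed.

Lemma conductor_gt0 q : conductor chi q -> (0 < q)%N.
Proof.
case: q => // -[[f [[f0 _] nz]] /(_ f)]; move/inU1P: f0 => f1 /(_ f1) e.
by rewrite e eqxx in nz.
Qed.

(** On [U_q] the character factors through [U_q / U_(q+1)], a group of order [p] generated by the
    class of [E_q]. *)
Lemma conductorE q : prime p -> conductor chi q ->
  [/\ chi (E p q) != 0, chi (E p q) *+ p = 0 &
      forall f, inU q f -> chi f = chi (E p q) *+ f q].
Proof.
move=> pr hq; have q0 := conductor_gt0 hq; case: hq => -[f [fq nz]] hq.
have H g : inU q g -> chi g = chi (E p q) *+ g q.
  by move=> gq; have [h [/hq h0 ->]] := char_leading q0 gq; rewrite h0 addr0.
have [Eq Eqq] := inU_E p q0; split=> //.
  by apply: contra nz => /eqP e; rewrite H // e mul0rn.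
rewrite -char_pow; last exact: inU_inU1 Eq.
have [P1 P2] := inU_pow p q0 Eq; apply/hq/inU_leading => //.
by rewrite P2 Eqq pchar_Fp_0.
Qed.

Lemma char_vanish q b f : conductor chi q -> (q < b)%N -> inU b f -> chi f = 0.
Proof. by move=> [_ hq] ltqb fb; apply: hq; apply: inU_le fb. Qed.

Lemma char_E_comp u d j : nottingham u -> (0 < d)%N -> (0 < j)%N ->
    (forall i, (1 < i <= d)%N -> u i = 0) ->
  exists h, [/\ inU (j + d) h, h (j + d)%N = j%:R * u d.+1 &
    chi (pscomp (E p j) u) = chi (E p j) + chi h].
Proof.
move=> nu d0 j0 ud; have [H1 H2] := E_comp_leading nu d0 j0 ud.
have E1 := inU_inU1 (inU_E p j0).1.
have jd0 : (0 < j + d)%N by lia.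
have [|h [h1 h2 h3]] := char_quotient jd0 _ E1 H1; first exact/inU_comp.
by exists h; rewrite h2 H2.
Qed.

End Characters.

Lemma conductor_comp p (chi : ps p -> 'Z_(p ^ 2)) u q :
  is_character chi -> nottingham u ->
  conductor chi q -> conductor (fun f => chi (pscomp f u)) q.
Proof.
move=> hchi nu [[f [fq nz]] hq]; split; last by move=> g gq; apply/hq/inU_comp.
have [g gE] := pscomp_surj f nu; have gU : inU q (pscomp g u).
  by apply: eq_inU fq => n; rewrite gE.
exists g; split; first exact/(inU_comp g q nu).
by rewrite (char_ext hchi (inU_inU1 gU) gE).
Qed.

Lemma has_typeP p (chi : ps p -> 'Z_(p ^ 2)) l m : prime p ->
  has_type chi l m <-> conductor (fun f => chi f *+ p) l /\ conductor chi m.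
Proof.
move=> pr; split=> [[[[f [fl nz]] hl] [hm1 hm2]]|[[[f [fl nz]] hl] [hm1 hm2]]].
  split; split=> //; last by move=> g; apply: hm2.
    by exists f; rewrite -dvdn_Zp2.
  by move=> g gl; apply/eqP; rewrite -dvdn_Zp2 // (hl l.+1).
split; split=> //; last by move=> b ltb g gb; apply: hm2; apply: inU_le gb.
  by exists f; rewrite dvdn_Zp2.
by move=> b ltb g gb; rewrite dvdn_Zp2 // hl //; apply: inU_le gb.
Qed.

(** The [E_i] with [i] prime to [p] generate [U_1] modulo [U_(m+1)]. *)
Lemma char_eq0 p (delta : ps p -> 'Z_(p ^ 2)) m : prime p -> is_character delta ->
    (forall f, inU m.+1 f -> delta f = 0) ->
    (forall i, (0 < i)%N -> ~~ (p %| i)%N -> delta (E p i) = 0) ->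
  forall f, inU1 f -> delta f = 0.
Proof.
move=> pr hd dm dE.
(* The remaining indices follow by descent: [E_(jp)] is the [p]-th power of [E_j], and [j < jp]. *)
have {}dE i : (0 < i)%N -> delta (E p i) = 0.
  elim/ltn_ind: i => i IHi i0; case: (boolP (p %| i)%N) => [|ndv]; last exact: dE.
  case/dvdnP=> j ij; have p1 := prime_gt1 pr.
  have j0 : (0 < j)%N by case: j ij i0 => [->|].
  have Ej := inU_inU1 (inU_E p j0).1.
  have Ej1 : inU1 (pspow (E p j) p) by case: (inU_pow p (ltn0Sn 0) Ej).
  have ltji : (j < i)%N by rewrite ij -{1}[j]muln1 ltn_pmul2l.
  by rewrite ij -(char_ext hd Ej1 (pspow_E_prime pr j0)) char_pow // IHi // mul0rn.
(* Stripping leading terms raises [j] until it exceeds [m]; [d] bounds the number of rounds. *)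
suff H d j f : (m < j + d)%N -> (0 < j)%N -> inU j f -> delta f = 0.
  by move=> f f1; apply: (H m 1%N).
elim: d j f => [|d IHd] j f lt j0 fj.
  by apply: dm; apply: inU_le fj; lia.
have [h [hj ->]] := char_leading hd j0 fj.
by rewrite dE // mul0rn add0r (IHd j.+1) //; lia.
Qed.

Lemma is_character_sub p (psi1 psi2 : ps p -> 'Z_(p ^ 2)) :
  is_character psi1 -> is_character psi2 -> is_character (fun f => psi1 f - psi2 f).
Proof.
move=> h1 h2; split=> [f g f1 g1|f f1].
  by rewrite (char_mul h1) // (char_mul h2) // opprD addrACA.
case: h1 h2 => _ /(_ f f1)[N1 H1] [_ /(_ f f1)[N2 H2]].
exists (maxn N1 N2) => g g1 gf; rewrite (H1 g) ?(H2 g) // => i lti; apply: gf; lia.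
Qed.

(** * Reduction by elementary substitutions *)

Definition twist p k (c : 'F_p) : ps p :=
  fun n => if n == 1%N then 1 else if n == k.+1 then c else 0.

Lemma twist_nottingham p k (c : 'F_p) : nottingham (twist k c).
Proof. by []. Qed.

Lemma twist_low p k (c : 'F_p) i : (1 < i <= k)%N -> twist k c i = 0.
Proof. by move=> /andP[i1 ik]; rewrite /twist gtn_eqF // ltn_eqF. Qed.

Lemma twist_lead p k (c : 'F_p) : (0 < k)%N -> twist k c k.+1 = c.
Proof. by case: k => // k _; rewrite /twist eqxx. Qed.

Lemma inU_div_t p k (u : ps p) : nottingham u ->
  (forall i, (1 < i <= k)%N -> u i = 0) -> inU k (div_t u).
Proof. by move=> [_ u1] uk; split=> // i i0 ik; apply: uk; lia. Qed.

Lemma nottingham_comp p (v u : ps p) :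
  nottingham v -> nottingham u -> nottingham (pscomp v u).
Proof.
move=> [v0 v1] nu; split; first by rewrite pscomp0.
by rewrite pscomp_recr // big_ord1 v0 mul0r add0r.
Qed.

(** As [j + k] is exactly the conductor, the shift is [j c] times [theta(E_(j+k))]; it runs through
    the whole [p]-torsion because [j] is invertible modulo [p]. *)
Lemma twist_adjust_E p (theta : ps p -> 'Z_(p ^ 2)) j k z :
    prime p -> is_character theta -> conductor theta (j + k) ->
    (0 < j)%N -> ~~ (p %| j)%N -> (0 < k)%N -> z *+ p = 0 ->
  exists c, theta (pscomp (E p j) (twist k c)) = theta (E p j) + z.
Proof.
move=> pr ht hq j0 ndv k0 zp; have [nz tor H] := conductorE ht pr hq.
have [c cE] := torsion_span pr tor zp nz; exists (c / j%:R).
have [h [h1 h2 ->]] := char_E_comp ht (twist_nottingham k (c / j%:R)) k0 j0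
  (fun i => @twist_low p k _ i).
rewrite (H h) // h2 twist_lead // mulrC divfK ?cE //.
by rewrite -(dvdn_pcharf (pchar_Fp pr)).
Qed.

Lemma twist_adjust_div_t p (theta : ps p -> 'Z_(p ^ 2)) k z :
    prime p -> is_character theta -> conductor theta k -> z *+ p = 0 ->
  exists c, theta (div_t (twist k c)) = z.
Proof.
move=> pr ht hq zp; have k0 := conductor_gt0 hq; have [nz tor H] := conductorE ht pr hq.
have [c cE] := torsion_span pr tor zp nz; exists c.
rewrite H; first by rewrite /div_t twist_lead.
by apply: inU_div_t => // i; apply: twist_low.
Qed.

(** The [p]-th power of an element of [U_l] lies in [U_(l+1)]. If [m <= l], [chi] would kill it, yet
    [p chi] is nonzero on [U_l]. *)
Lemma conductor_lt p (chi : ps p -> 'Z_(p ^ 2)) l m : prime p -> is_character chi ->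
  conductor (fun f => chi f *+ p) l -> conductor chi m -> (l < m)%N.
Proof.
move=> pr hchi hl hm; rewrite ltnNge; apply/negP => leml.
have l0 := conductor_gt0 hl; case: hl => -[f [fl /negP[]]].
have [P1 P2] := inU_pow p l0 fl; rewrite -(char_pow hchi p (inU_inU1 fl)).
apply/eqP/hm.2/(@inU_le _ _ _ l.+1) => //; apply: inU_leading => //.
by rewrite P2 -mulr_natr pchar_Fp_0 // mulr0.
Qed.

(** * Existence of a reduced form *)

Section Existence.
Variables (p l m : nat) (chi : ps p -> 'Z_(p ^ 2)).
Hypotheses (pr : prime p) (hlp : (l < p)%N) (hchi : is_character chi).
Hypotheses (hl : conductor (fun f => chi f *+ p) l) (hm : conductor chi m).

(* After the substitutions of depth less than [k], the conditions that the
   substitutions of depth at least [k] leave intact hold. *)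
Definition normalized k (u : ps p) :=
  [/\ nottingham u,
      forall i, (0 < i < l)%N -> (l < i + k)%N -> chi (pscomp (E p i) u) *+ p = 0,
      (l < k)%N -> chi (div_t u) *+ p = 0,
      forall i, (0 < i < m - l)%N -> ~~ (p %| i)%N -> (m < i + k)%N ->
        (chi (pscomp (E p i) u) < p)%N
    & (m < k)%N -> chi (div_t u) = 0].

Let l0 : (0 < l)%N := conductor_gt0 hl.
Let ltlm : (l < m)%N := conductor_lt pr hchi hl hm.

(** The four requirements concern disjoint ranges of [k], so at most one is in force and a single
    coefficient [c] can meet it. *)
Lemma choose_twist k u : (0 < k)%N -> normalized k u ->
  let psi f := chi (pscomp f u) in
  exists c,
  [/\ (k < l)%N -> psi (pscomp (E p (l - k)) (twist k c)) *+ p = 0,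
      k = l -> (psi (div_t (twist k c)) + chi (div_t u)) *+ p = 0,
      (l < k < m)%N -> ~~ (p %| m - k)%N ->
        (psi (pscomp (E p (m - k)) (twist k c)) < p)%N
    & k = m -> psi (div_t (twist k c)) + chi (div_t u) = 0].
Proof.
move=> k0 [nu _ ul _ _] psi; have hpsi : is_character psi := is_character_comp hchi nu.
have htheta : is_character (fun f => psi f *+ p) := is_character_mulrn hpsi p.
have hlp' : conductor (fun f => psi f *+ p) l := conductor_comp (is_character_mulrn hchi p) nu hl.
have hmp : conductor psi m := conductor_comp hchi nu hm.
have tor2 (z : 'Z_(p ^ 2)) : z *+ p *+ p = 0.
  rewrite -mulrnA mulrn_nat_Zp2 mulnA; have [_] := @natr_Zp2_eq p (z * p)%N 0 pr.
  by rewrite mul0n; apply; rewrite natrM pchar_Fp_0 // mulr0.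
case: (ltngtP k l) => [ltkl|ltlk|->].
- have e : (l = l - k + k)%N by lia.
  (* Here [l < p] enters: [0 < l - k < p]. *)
  have nd : ~~ (p %| l - k)%N by apply/negP => /dvdn_leq; lia.
  have [c cE] : exists c, psi (pscomp (E p (l - k)) (twist k c)) *+ p = 0.
    rewrite e in hlp'.
    have [||c cE] := twist_adjust_E (z := - (psi (E p (l - k)) *+ p)) pr htheta hlp' _ nd k0.
    + by lia.
    + by rewrite mulNrn tor2 oppr0.
    by exists c; rewrite cE subrr.
  by exists c; split=> //; lia.
- case: (ltngtP k m) => [ltkm|ltmk|e].
  + case: (boolP (p %| m - k)%N) => dv; first by exists 0; split=> //; lia.
    (* [r] is the residue of [z] modulo [p], so [r - z] is [p]-torsion and an admissible shift. *)
    pose z := psi (E p (m - k)); pose r : 'Z_(p ^ 2) := ((z %% p)%N)%:R.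
    have e : (m = m - k + k)%N by lia.
    rewrite e in hmp.
    have [||c cE] := twist_adjust_E (z := r - z) pr hpsi hmp _ dv k0.
    * by lia.
    * apply/eqP; rewrite mulrnBl subr_eq0 [z *+ p]mulrn_nat_Zp2 -mulrnA; apply/eqP/natr_Zp2_eq => //.
      by apply: val_inj; rewrite /= !(val_Fp_nat pr) modn_mod.
    exists c; split=> //; try lia; move=> _ _; rewrite cE -/z addrC subrK /r.
    rewrite (val_Zp_nat (prime_sqr_gt1 pr)); apply: leq_ltn_trans (leq_mod _ _) _.
    by rewrite ltn_mod prime_gt0.
  + by exists 0; split=> //; lia.
  (* Depth [l < m] has already put [chi(u/t)] into the [p]-torsion, as the shift requires. *)
  + rewrite e in ltlk *.
    have [|c cE] := twist_adjust_div_t (z := - chi (div_t u)) pr hpsi hmp.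
      by rewrite mulNrn ul ?oppr0 // e.
    by exists c; split=> //; try lia; rewrite cE addNr.
- have [|c cE] := twist_adjust_div_t (z := - (chi (div_t u) *+ p)) pr htheta hlp'.
    by rewrite mulNrn tor2 oppr0.
  by exists c; split=> //; try lia; rewrite mulrnDl cE addNr.
Qed.

(** The twist goes outside, as in [f(v(u))], hence acts on the already transformed character, whose
    conductors are unchanged. Conditions attained earlier change only by values beyond a conductor;
    the borderline one is met by [choose_twist]. *)
Lemma normalized_step k u : (0 < k)%N -> normalized k u -> exists u', normalized k.+1 u'.
Proof.
move=> k0 nuk; have [c [C1 C2 C3 C4]] := choose_twist k0 nuk.
have [nu U1 U2 U3 U4] := nuk; set v := twist k c in C1 C2 C3 C4.
have nv : nottingham v := twist_nottingham k c.
have [u0 _] := nu; have [v0 _] := nv.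
have hpsi := is_character_comp hchi nu.
have vl i : (1 < i <= k)%N -> v i = 0 by apply: twist_low.
have vU := inU_div_t nv vl.
have compE i : (0 < i)%N ->
    chi (pscomp (E p i) (pscomp v u)) = chi (pscomp (pscomp (E p i) v) u).
  move=> i0; apply/esym/(char_ext hchi); last exact: pscompA.
  by do 2!apply/inU_comp => //; exact: inU_inU1 (inU_E p i0).1.
have divE : chi (div_t (pscomp v u)) = chi (pscomp (div_t v) u) + chi (div_t u).
  have du : inU1 (div_t u) by case: nu => _ u1; apply/inU1P.
  have dv : inU1 (pscomp (div_t v) u) by apply/inU_comp => //; apply: inU_inU1 vU.
  rewrite -(char_mul hchi) //; apply/esym/(char_ext hchi) => [|n].
    by case: (inU_mul (ltn0Sn 0) dv du).
  by rewrite div_t_comp.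
have shift i : (0 < i)%N -> exists h, inU (i + k) h /\
    chi (pscomp (E p i) (pscomp v u)) = chi (pscomp (E p i) u) + chi h.
  move=> i0; have [h [h1 _ hE]] := char_E_comp hpsi nv k0 i0 vl.
  by exists (pscomp h u); rewrite compE // hE; split=> //; apply/inU_comp.
have thl := @char_vanish p (fun f => chi f *+ p) l.
exists (pscomp v u); split; first exact: nottingham_comp.
- move=> i /andP[i0 il] lik; case: (ltngtP l (i + k)) => [lt|gt|e]; last 2 first.
  + by lia.
  + by rewrite compE // (_ : i = l - k)%N ?C1 //; lia.
  have [h [hU ->]] := shift i i0; rewrite mulrnDl U1 ?i0 // add0r.
  exact: (thl _ _ hl lt hU).
- rewrite ltnS => lelk; rewrite divE; case: (ltngtP l k) => [lt|gt|e]; last 2 first.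
  + by lia.
  + exact: C2.
  rewrite mulrnDl U2 // addr0; apply: (thl _ _ hl lt).
  exact/inU_comp.
- move=> i /andP[i0 il] ndv lik; case: (ltngtP m (i + k)) => [lt|gt|e]; last 2 first.
  + by lia.
  + have e' : (i = m - k)%N by lia.
    by rewrite compE // e' C3 -?e' //; lia.
  have [h [hU ->]] := shift i i0.
  by rewrite (char_vanish hm lt hU) addr0 U3 ?i0.
- rewrite ltnS => lemk; rewrite divE; case: (ltngtP m k) => [lt|gt|e]; last 2 first.
  + by lia.
  + exact: C4.
  rewrite U4 // addr0; apply: (char_vanish hm lt).
  exact/inU_comp.
Qed.

Lemma normalized_exists k : (0 < k)%N -> exists u, normalized k u.
Proof.
elim: k => // -[_ _|k IHk _]; last by have [//|u] := IHk; apply: normalized_step.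
(* The identity substitution: at [k = 1] all conditions are vacuous, as [0 < l < m]. *)
exists (twist 1 0); split=> //; lia.
Qed.

Lemma reduced_exists : exists psi,
  [/\ is_character psi, surjective_char chi -> surjective_char psi, has_type psi l m,
      reduced_form psi l m & strict_equiv chi psi].
Proof.
have [u [nu U1 _ U3 U4]] := normalized_exists (ltn0Sn m).
pose psi f := chi (pscomp f u).
have hpsi : is_character psi := is_character_comp hchi nu.
have hlp' : conductor (fun f => psi f *+ p) l := conductor_comp (is_character_mulrn hchi p) nu hl.
have hmp : conductor psi m := conductor_comp hchi nu hm.
exists psi; split=> //; last by exists u; split=> //; split=> //; apply: U4.
- move=> surj z; have [f [f1 fz]] := surj z; have [g gE] := pscomp_surj f nu.
  have gU : inU1 (pscomp g u) by apply: eq_inU f1 => n; rewrite gE.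
  exists g; split; first exact/(inU_comp g 1 nu).
  by rewrite /psi (char_ext hchi gU gE).
- exact/has_typeP.
(* Below [l] normalization kills the value modulo [p]; above [l] the conductor of [p psi] does. *)
have dvE i : (0 < i)%N -> i != l -> (p %| psi (E p i))%N.
  move=> i0 nil; rewrite dvdn_Zp2 //; apply/eqP.
  case: (ltngtP i l) nil => // [lt|lt] _; first by apply: U1; rewrite ?i0 //; lia.
  exact: (char_vanish hlp' lt (inU_E p i0).1).
have m0 : (0 < m)%N := conductor_gt0 hm.
(* Base-[p] digits: the low digit at [l] gives [x], the high digits give [b]. *)
exists (psi (E p l) %% p)%N, (fun i => psi (E p i) %/ p)%N; split.
- rewrite ltn_mod (prime_gt0 pr) andbT lt0n.
  by have [+ _ _] := conductorE (is_character_mulrn hpsi p) pr hlp'; rewrite -dvdn_Zp2.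
- by move=> j; rewrite ltn_divLR ?prime_gt0 // mulnn ltn_Zp2.
(* Since [m > l], the value at [E_m] is a nonzero multiple of [p], so its high digit is nonzero. *)
- move=> _; have [nz _ _] := conductorE hpsi pr hmp.
  have := dvE m m0; rewrite gtn_eqF // => /(_ isT) /divnK e.
  by apply: contra nz => /eqP e0; apply/eqP/val_inj; rewrite /= -e e0.
move=> i i0 ndv; rewrite -[LHS]natr_Zp; congr (_%:R).
have [->|nil] := eqVneq i l.
  (* If [l] lies outside the window, then [l < m - l], where normalization has removed the high
     digit. *)
  case: ifP => H; first by rewrite addnC mulnC -divn_eq.
  rewrite muln0 addn0 modn_small //; apply: U3; rewrite ?l0 //=; first by lia.
    by apply/negP => /dvdn_leq; lia.
  by lia.
rewrite add0n; have dv := dvE i i0 nil.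
case: ifP => H; first by rewrite mulnC divnK.
(* Below the window the value is a multiple of [p] and less than [p], hence zero; above [m] the
   conductor applies. *)
rewrite muln0; case: (leqP i m) => [lem|ltm].
  have := U3 i; rewrite i0 /= => /(_ _ ndv) lt.
  have {}lt : (psi (E p i) < p)%N by apply: lt; lia.
  by apply/eqP; move: dv; apply: contraLR; rewrite -lt0n => gt; apply/negP => /dvdn_leq; lia.
by rewrite (char_vanish hmp ltm (inU_E p i0).1).
Qed.

End Existence.

(** * Uniqueness of the reduced form *)

Lemma eq_conductor p (psi1 psi2 : ps p -> 'Z_(p ^ 2)) q :
  (forall f, inU1 f -> psi1 f = psi2 f) -> conductor psi1 q -> conductor psi2 q.
Proof.
move=> e [[f [fq nz]] hq]; split=> [|g gq].
  by exists f; rewrite -e //; apply: inU_inU1 fq.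
by rewrite -e ?hq //; apply: inU_inU1 gq.
Qed.

Lemma reduced_torsion p (psi : ps p -> 'Z_(p ^ 2)) l m i : prime p ->
  reduced_form psi l m -> (0 < i)%N -> ~~ (p %| i)%N -> i != l ->
  psi (E p i) *+ p = 0.
Proof.
move=> pr [x [b [_ _ _ H]]] i0 ndv nil; apply/eqP; rewrite -dvdn_Zp2 //.
rewrite H // (negPf nil) add0n (val_Zp_nat (prime_sqr_gt1 pr)) -mulnn.
by rewrite -muln_modr dvdn_mulr.
Qed.

Lemma reduced_equiv_depth p (psi1 psi2 : ps p -> 'Z_(p ^ 2)) l m u :
    prime p -> (l < p)%N -> is_character psi1 ->
    conductor (fun f => psi1 f *+ p) l ->
    reduced_form psi1 l m -> reduced_form psi2 l m -> nottingham u ->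
    (forall f, inU1 f -> psi2 f = psi1 (pscomp f u)) -> psi1 (div_t u) = 0 ->
  forall i, (1 < i <= l.+1)%N -> u i = 0.
Proof.
move=> pr hlp h1 hl r1 r2 nu e12 s0; elim/ltn_ind=> -[//|k] IHk.
rewrite !ltnS => /andP[k0 lekl].
have uk i : (1 < i <= k)%N -> u i = 0 by move=> ik; apply: IHk; lia.
have ht := is_character_mulrn h1 p; have [nz tor H] := conductorE ht pr hl.
(* Depth [k = l] is settled by [psi1(u/t) = 0], smaller depths by [E_(l-k)], where [p psi1] and
   [p psi2] both vanish. *)
case: (ltngtP k l) lekl => // [ltkl|e] _; last first.
  have := H _ (inU_div_t nu (k := l) _); rewrite -e s0 mul0rn => /(_ uk) /esym.
  by rewrite e; apply: mulrn_Fp_eq0.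
have j0 : (0 < l - k)%N by lia.
have nd : ~~ (p %| l - k)%N by apply/negP => /dvdn_leq; lia.
have nil : (l - k)%N != l by lia.
have E1 : inU1 (E p (l - k)) := inU_inU1 (inU_E p j0).1.
have [h [hU hE]] := char_E_comp ht nu k0 j0 uk.
rewrite -e12 // (reduced_torsion pr r2) // (reduced_torsion pr r1) // add0r => /esym.
rewrite subnK ?(ltnW ltkl) // in hU hE.
rewrite H // hE => /(mulrn_Fp_eq0 pr tor nz) /eqP.
by rewrite mulf_eq0 -(dvdn_pcharf (pchar_Fp pr)) (negPf nd) => /eqP.
Qed.

Lemma reduced_unique p (psi1 psi2 : ps p -> 'Z_(p ^ 2)) l m u :
    prime p -> (l < p)%N -> is_character psi1 -> is_character psi2 ->
    conductor (fun f => psi1 f *+ p) l -> conductor psi1 m ->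
    reduced_form psi1 l m -> reduced_form psi2 l m -> nottingham u ->
    (forall f, inU1 f -> psi2 f = psi1 (pscomp f u)) -> psi1 (div_t u) = 0 ->
  forall f, inU1 f -> psi1 f = psi2 f.
Proof.
move=> pr hlp h1 h2 hl hm r1 r2 nu e12 s0 f f1.
have ud := reduced_equiv_depth pr hlp h1 hl r1 r2 nu e12 s0.
apply/eqP; rewrite -subr_eq0; apply/eqP; move: f f1.
apply: (char_eq0 (m := m) pr (is_character_sub h1 h2)) => [f fm|i i0 ndv].
  rewrite e12; last exact: inU_inU1 fm.
  by rewrite (hm.2 f fm) (hm.2 (pscomp f u)) ?subrr //; apply/inU_comp.
have E1 : inU1 (E p i) := inU_inU1 (inU_E p i0).1.
(* Here [h] lies in [U_(i+l+1)]: beyond [m] when [i >= m - l], and beyond [l] always. *)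
have [h [hU _]] := char_E_comp h1 nu (ltn0Sn l) i0 ud.
rewrite -e12 // => psi2E.
case: (leqP (m - l) i) => [le|lt].
  by rewrite psi2E (char_vanish hm _ hU) ?addr0 ?subrr //; lia.
have tor : psi1 (E p i) *+ p = psi2 (E p i) *+ p.
  rewrite psi2E mulrnDl; have /= -> := char_vanish hl _ hU; last by lia.
  by rewrite addr0.
(* Below the window no [b]-term occurs, so the value is an integer less than [p], determined by
   [p psi(E_i)]. *)
have small psi : reduced_form psi l m ->
    exists2 x, (x < p)%N & psi (E p i) = x%:R.
  case=> [x [b [/andP[x0 xp] _ _ H]]]; rewrite H //.
  rewrite (leqNgt (m - l) i) lt /= muln0 addn0.
  by exists (if i == l then x else 0)%N => //; case: ifP => // _; apply: prime_gt0.
have [x1 x1p e1] := small _ r1; have [x2 x2p e2] := small _ r2.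
move: tor; rewrite e1 e2 -!mulrnA => /(natr_Zp2_eq _ _ pr) /(congr1 (@nat_of_ord _)).
by rewrite !(val_Fp_nat pr) !modn_small // => ->; rewrite subrr.
Qed.

Theorem theorem1p2 (p l m : nat) (hp : prime p) (hlp : (l < p)%N)
  (chi : ps p -> 'Z_(p ^ 2))
  (hchi : is_character chi) (hsurj : surjective_char chi) (htype : has_type chi l m) :
  (exists psi : ps p -> 'Z_(p ^ 2),
     [/\ is_character psi, surjective_char psi, has_type psi l m,
         reduced_form psi l m & strict_equiv chi psi]) /\
  (forall psi1 psi2 : ps p -> 'Z_(p ^ 2),
     is_character psi1 -> is_character psi2 ->
     reduced_form psi1 l m -> reduced_form psi2 l m ->
     strict_equiv chi psi1 -> strict_equiv chi psi2 ->
     forall f, inU1 f -> psi1 f = psi2 f).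
Proof.
move/has_typeP: htype => /(_ hp)[hl hm]; split.
  have [psi [h1 h2 h3 h4 h5]] := reduced_exists hp hlp hchi hl hm.
  by exists psi; split=> //; apply: h2.
move=> psi1 psi2 h1 h2 r1 r2 [u1 [nu1 [e1 s1]]] [u2 [nu2 [e2 s2]]].
(* [u] solves [u(u1) = u2], so it carries [psi1] to [psi2]. *)
have [u uE] := pscomp_surj u2 nu1; have [u10 u11] := nu1.
have u0 : u 0%N = 0 by rewrite -(pscomp0 u u1) uE; case: nu2.
have nu : nottingham u.
  by split=> //; case: nu2 => _; rewrite -uE pscomp_recr // big_ord1 u0 mul0r add0r.
have compU j (f w : ps p) : nottingham w -> inU j f -> inU j (pscomp f w).
  by move=> nw fj; apply/inU_comp.
apply: (reduced_unique (m := m) (l := l) (u := u)) => //.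
- apply: (eq_conductor (psi1 := fun f => chi (pscomp f u1) *+ p)) => [f f1|].
    by rewrite e1.
  exact: (conductor_comp (is_character_mulrn hchi p) nu1 hl).
- apply: (eq_conductor (psi1 := fun f => chi (pscomp f u1))) => [f f1|].
    by rewrite e1.
  exact: conductor_comp.
- move=> f f1; rewrite e2 // e1; last exact: compU.
  apply: (char_ext hchi) => [|n]; first exact: compU.
  by rewrite pscompA //; apply: eq_pscomp => k; rewrite uE.
have du : inU1 (div_t u) by case: nu => _ ?; apply/inU1P.
have du1 : inU1 (div_t u1) by apply/inU1P.
(* Cocycle rule: [psi1(u/t) + chi(u1/t) = chi(u2/t)], and both [chi] terms vanish. *)
rewrite e1 //; apply: (addIr (chi (div_t u1))); rewrite -(char_mul hchi) //; last exact: compU.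
rewrite s1 addr0 -s2; apply: (char_ext hchi) => [|n].
  by case: (inU_mul (ltn0Sn 0) (compU 1%N _ _ nu1 du) du1).
by rewrite -div_t_comp // /div_t uE.
Qed.
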